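(* Let $N\ge1$, let $\beta_1,\dots,\beta_N\in[0,1]$, and consider the aggregation rule FedDA, $$\widehat g_{\mathrm{FedDA}}(\theta)=\frac1N\sum_{i=1}^N\left((1-\beta_i)\,g_{\widehat{\mathcal D}_T}(\theta)+\beta_i\,g_{\mathcal D_{S_i}}(\theta)\right).$$ Given the target domain dataset $\widehat{\mathcal D}_T$ and $N$ source domains $\mathcal D_{S_1},\dots,\mathcal D_{S_N}$, we have $$\Delta^2_{\mathrm{FedDA}}\le\frac1N\sum_{i=1}^N\Delta^2_{\mathrm{FedDA},S_i},\qquad\text{where}\qquad \Delta^2_{\mathrm{FedDA},S_i}=(1-\beta_i)^2\,\sigma_\pi^2(\widehat{\mathcal D}_T)+\beta_i^2\,d_\pi^2(\mathcal D_{S_i},\mathcal D_T).$$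
   Context: Setting. $\mathcal Z$ is a ground set of data points, $\Theta=\mathbb{R}^m$ is the parameter space with Euclidean norm $\|\cdot\|$, and $\ell:\Theta\times\mathcal Z\to\mathbb{R}_+$ is a loss, differentiable in $\theta$; $\nabla$ denotes the gradient in $\theta$. For a distribution $\mathcal D$ on $\mathcal Z$, $\ell_{\mathcal D}(\theta):=\mathbb{E}_{z\sim\mathcal D}\,\ell(\theta,z)$ and $g_{\mathcal D}(\theta):=\nabla\ell_{\mathcal D}(\theta)$; for a finite dataset $\widehat{\mathcal D}$, $\ell_{\widehat{\mathcal D}}(\theta):=\frac{1}{|\widehat{\mathcal D}|}\sum_{z\in\widehat{\mathcal D}}\ell(\theta,z)$ and $g_{\widehat{\mathcal D}}:=\nabla\ell_{\widehat{\mathcal D}}$. Given a probability measure $\pi$ on $\Theta$, $\|g\|_\pi:=\sqrt{\mathbb{E}_{\theta\sim\pi}\|g(\theta)\|^2}$ for $g:\Theta\to\Theta$, and $L^\pi:=\{g:\Theta\to\Theta\mid\|g\|_\pi<\infty\}$. All gradient functions involved are taken to lie in $L^\pi$. The source domains $\mathcal D_{S_1},\dots,\mathcal D_{S_N}$ are fixed distributions on $\mathcal Z$. The target dataset $\widehat{\mathcal D}_T=\{z_1,\dots,z_n\}$ consists of $n$ i.i.d. samples from the target domain $\mathcal D_T$; in particular $\mathbb{E}_{\widehat{\mathcal D}_T}[g_{\widehat{\mathcal D}_T}]=g_{\mathcal D_T}$. Quantities: - Delta error: $\Delta^2_{\mathrm{FedDA}}:=\mathbb{E}_{\widehat{\mathcal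 D}_T}\|g_{\mathcal D_T}-\widehat g_{\mathrm{FedDA}}\|_\pi^2$. - Target domain variance: $\sigma_\pi^2(\widehat{\mathcal D}_T):=\mathbb{E}_{\widehat{\mathcal D}_T}\|g_{\mathcal D_T}-g_{\widehat{\mathcal D}_T}\|_\pi^2$, assumed finite. - Source–target distance: $d_\pi(\mathcal D_S,\mathcal D_T):=\|g_{\mathcal D_T}-g_{\mathcal D_S}\|_\pi$. *)

(* Defs.v *)
From HB Require Import structures.
From mathcomp Require Import all_boot all_order all_algebra.
From mathcomp Require Import all_classical all_reals all_analysis.
Import Order.TTheory GRing.Theory Num.Theory.
Import numFieldNormedType.Exports.

Set Implicit Arguments.
Unset Strict Implicit.
Unset Printing Implicit Defensive.

Local Open Scope classical_set_scope.
Local Open Scope ring_scope.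

(* Matrices (hence row vectors) over a realType carry the Borel sigma-algebra
   of their library topology, which is that of the sup norm and thus coincides
   with the Euclidean one. *)
HB.instance Definition _ (R : realType) (m n : nat) :=
  Measurable.copy 'M[R]_(m, n) (g_sigma_algebraType (@open 'M[R]_(m, n))).

(* The library norm on 'rV[R]_m is the sup norm, so the Euclidean norm needs
   its own definition. *)
Definition enorm (R : realType) (m : nat) (v : 'rV[R]_m) : R :=
  Num.sqrt (\sum_(i < m) v 0 i ^+ 2).

Definition gradient (R : realType) (m : nat) (f : 'rV[R]_m -> R)
    (theta : 'rV[R]_m) : 'rV[R]_m :=
  \row_(i < m) 'D_(delta_mx 0 i) f theta.

Section FunctionNorm.
Local Open Scope ereal_scope.
Context {R : realType} {m : nat} (pi : probability 'rV[R]_m R).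

Definition norm_pi (g : 'rV[R]_m -> 'rV[R]_m) : \bar R :=
  sqrte (\int[pi]_theta (enorm (g theta) ^+ 2)%:E).

Definition in_Lpi (g : 'rV[R]_m -> 'rV[R]_m) : Prop :=
  measurable_fun setT g /\ norm_pi g < +oo.

End FunctionNorm.

Section Risks.
Context {R : realType} {m : nat} {dZ : measure_display} {Z : measurableType dZ}.
Variable loss : 'rV[R]_m -> Z -> R.

(* [fine] only returns the true expectation when it is finite; see
   [regular_domain]. *)
Definition risk (D : probability Z R) (theta : 'rV[R]_m) : R :=
  fine 'E_D[loss theta].

Definition grad_risk (D : probability Z R) : 'rV[R]_m -> 'rV[R]_m :=
  gradient (risk D).

(* Datasets are families indexed by 'I_n, so repeated points are counted with
   multiplicity. *)
Definition emp_risk (n : nat) (data : 'I_n -> Z) (theta : 'rV[R]_m) : R :=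
  n%:R^-1 * \sum_(j < n) loss theta (data j).

Definition grad_emp_risk (n : nat) (data : 'I_n -> Z) : 'rV[R]_m -> 'rV[R]_m :=
  gradient (emp_risk data).

(* What makes the population gradient of the domain D meaningful. *)
Definition regular_domain (D : probability Z R) : Prop :=
  (forall theta, D.-integrable setT (EFin \o loss theta)) /\
  (forall theta, differentiable (risk D) theta).

End Risks.

Section IID.
Local Open Scope ereal_scope.
Context {R : realType} {dO dZ : measure_display}.
Context {Omega : measurableType dO} {Z : measurableType dZ}.
Context (P : probability Omega R) {n : nat}.

Definition mutually_independent (X : 'I_n -> {RV P >-> Z}) : Prop :=
  forall (J : {set 'I_n}) (A : 'I_n -> set Z),
    (forall j, measurable (A j)) ->
    P (\bigcap_(j in [set` J]) (X j @^-1` A j)) =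
    \prod_(j in J) P (X j @^-1` A j).

Definition iid_samples (D : probability Z R) (X : 'I_n -> {RV P >-> Z}) : Prop :=
  mutually_independent X /\
  (forall j (A : set Z), measurable A -> distribution P (X j) A = D A).

End IID.

Section Errors.
Local Open Scope ereal_scope.
Context {R : realType} {m : nat} (pi : probability 'rV[R]_m R).
Context {dO dZ : measure_display}.
Context {Omega : measurableType dO} {Z : measurableType dZ}.
Context (P : probability Omega R) (loss : 'rV[R]_m -> Z -> R).
Context (DT : probability Z R).

(* The aggregated gradient depends on the outcome w through the target sample. *)
Definition delta_error2 (ghat : Omega -> 'rV[R]_m -> 'rV[R]_m) : \bar R :=
  \int[P]_w (norm_pi pi (grad_risk loss DT \- ghat w)%R) ^+ 2.

Definition target_variance {n : nat} (X : 'I_n -> {RV P >-> Z}) : \bar R :=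
  \int[P]_w (norm_pi pi
    (grad_risk loss DT \- grad_emp_risk loss (fun j => X j w))%R) ^+ 2.

Definition dist_pi (DS : probability Z R) : \bar R :=
  norm_pi pi (grad_risk loss DT \- grad_risk loss DS)%R.

Definition delta_error2_source {n : nat} (X : 'I_n -> {RV P >-> Z})
    (beta : R) (DS : probability Z R) : \bar R :=
  ((1 - beta) ^+ 2)%:E * target_variance X + (beta ^+ 2)%:E * dist_pi DS ^+ 2.

End Errors.

Definition fedda {R : realType} {m : nat} {dZ : measure_display}
    {Z : measurableType dZ} (loss : 'rV[R]_m -> Z -> R) {N : nat}
    (beta : 'I_N -> R) (DS : 'I_N -> probability Z R)
    {n : nat} (data : 'I_n -> Z) (theta : 'rV[R]_m) : 'rV[R]_m :=
  N%:R^-1 *: \sum_(i < N)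
    ((1 - beta i) *: grad_emp_risk loss data theta
       + beta i *: grad_risk loss (DS i) theta).

(* Main.v *)
(* With A = g_{D_T} - g_{\hat D_T} and B_i = g_{D_T} - g_{D_{S_i}}, the error of
   FedDA is the average over i of (1 - beta_i) A + beta_i B_i, so by convexity
   of the square it is enough to compute the expected squared L^pi norm of each
   term.  There the cross term integrates to 0: on the product of the sample
   space with (Theta, pi) it is dominated by |A|^2 + |B_i|^2, so Fubini allows
   integrating over the sample first, where A has mean 0 and B_i is constant.
   Joint measurability of the empirical gradient comes from writing partial
   derivatives as limits of difference quotients along 1/(k+1). *)
Require Import Defs.
From HB Require Import structures.
From mathcomp Require Import all_boot all_order all_algebra.
From mathcomp Require Import all_classical all_reals all_analysis.
From mathcomp Require Import measurable_realfun ring lra.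
Import Order.TTheory GRing.Theory Num.Theory.
Import numFieldNormedType.Exports.

Local Open Scope classical_set_scope.
Local Open Scope ring_scope.

(** * Borel measurability of matrix functions and of partial derivatives *)

Lemma continuous_mx_measurable (R : realType) (m n : nat)
    (f : 'M[R]_(m, n) -> R) :
  continuous f -> measurable_fun setT f.
Proof.
move=> /continuousP cf.
apply: (measurability _ (RGenOpens.measurableE R) ) => _ [_ [a [b ->] <-]].
by rewrite setTI; apply: sub_sigma_algebra; apply: cf; exact: interval_open.
Qed.

Lemma measurable_coord (R : realType) (m n : nat) (i : 'I_m) (j : 'I_n) :
  measurable_fun setT (fun M : 'M[R]_(m, n) => M i j).
Proof. by apply: continuous_mx_measurable; exact: coord_continuous. Qed.

Lemma measurable_mx_translation (R : realType) (m n : nat) (v : 'M[R]_(m, n)) :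
  measurable_fun setT (fun M : 'M[R]_(m, n) => v + M).
Proof.
apply: (measurability (@open 'M[R]_(m, n))) => // _ [U oU <-].
rewrite setTI; apply: sub_sigma_algebra.
have /continuousP : continuous (fun M : 'M[R]_(m, n) => v + M).
  by move=> x; apply: continuousD; [exact: cst_continuous|exact: cvg_id].
exact.
Qed.

(** Measurability is joint in the parameter and the data point, as Tonelli and Fubini require
    later. *)
Lemma measurable_derive_param (R : realType) (m n : nat) (d : measure_display)
    (Z : measurableType d) (f : 'M[R]_(m, n) -> Z -> R) (v : 'M[R]_(m, n)) :
  measurable_fun setT (fun p : 'M[R]_(m, n) * Z => f p.1 p.2) ->
  (forall x z, derivable (f ^~ z) x v) ->
  measurable_fun setT (fun p : 'M[R]_(m, n) * Z => 'D_v (f ^~ p.2) p.1).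
Proof.
move=> mf df.
(* The step [harmonic k] is 1/(k+1), nonzero already at k = 0, so the sequence stays in the
   punctured neighbourhood where the derivative is a limit. *)
pose q (k : nat) (p : 'M[R]_(m, n) * Z) : R :=
  (@harmonic R k)^-1 * (f (@harmonic R k *: v + p.1) p.2 - f p.1 p.2).
apply: (@measurable_fun_cvg _ _ _ _ q) => [k|[x z] _].
  apply: measurable_funM; first exact: measurable_cst.
  apply: measurable_funB => //.
  apply: (measurableT_comp (g := fun p => (@harmonic R k *: v + p.1, p.2)) mf).
  apply: measurable_fun_pair => //=.
  exact: measurableT_comp (measurable_mx_translation _ _ _ _) measurable_fst.
have /cvg_ex[l hl] := df x z.
have -> : 'D_v (f ^~ z) x = l by exact: cvg_lim hl.
have /cvgr_dnbhsP := hl.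
move/(_ (@harmonic R)); apply; split; last exact: cvg_harmonic.
by move=> k; rewrite gt_eqF// invr_gt0.
Qed.

(** * Coordinate formulas, squared norms and change of variables *)

Lemma grad_emp_riskE (R : realType) (m : nat) (d : measure_display)
    (Z : measurableType d) (loss : 'rV[R]_m -> Z -> R) (n : nat)
    (data : 'I_n -> Z) (x : 'rV[R]_m) (k : 'I_m) :
  (forall z t, differentiable (loss ^~ z) t) ->
  grad_emp_risk loss data x 0 k =
  n%:R^-1 * \sum_(j < n) gradient (loss ^~ (data j)) x 0 k.
Proof.
move=> dl; rewrite mxE.
have dj j : derivable (loss ^~ (data j)) x (delta_mx 0 k).
  exact: diff_derivable.
have -> : emp_risk loss data =
    n%:R^-1 \*: (\sum_(j < n) loss ^~ (data j)).
  by apply/funext => t; rewrite /emp_risk /= fct_sumE.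
rewrite deriveZ; last exact: derivable_sum.
by rewrite derive_sum//; congr (_ * _); apply: eq_bigr => j _; rewrite mxE.
Qed.

(** Unlike [mxE], this leaves the entries of a [gradient], itself a [\row_], folded. *)
Lemma mxBE (R : realType) (m n : nat) (A B : 'M[R]_(m, n)) i j :
  (A - B) i j = A i j - B i j.
Proof. by rewrite !mxE. Qed.

Lemma fedda_coord (R : realType) (m : nat) (d : measure_display)
    (Z : measurableType d) (loss : 'rV[R]_m -> Z -> R) (N : nat)
    (beta : 'I_N -> R) (DS : 'I_N -> probability Z R) (n : nat)
    (data : 'I_n -> Z) (x : 'rV[R]_m) (k : 'I_m) :
  fedda loss beta DS data x 0 k = N%:R^-1 * \sum_(i < N)
    ((1 - beta i) * grad_emp_risk loss data x 0 k +
     beta i * grad_risk loss (DS i) x 0 k).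
Proof.
rewrite /fedda; move: (grad_emp_risk loss data x) => u.
rewrite mxE summxE; congr (_ * _); apply: eq_bigr => i _.
by move: (grad_risk loss (DS i) x) => v; rewrite !mxE.
Qed.

Lemma enorm_sqr (R : realType) (m : nat) (v : 'rV[R]_m) :
  enorm v ^+ 2 = \sum_(i < m) v 0 i ^+ 2.
Proof. by rewrite sqr_sqrtr// sumr_ge0// => i _; exact: sqr_ge0. Qed.

(** Convexity of the square with equal weights: the sum of squared deviations from the mean [c] is
    nonnegative and equals the sum of squares minus N c^2. *)
Lemma sqr_mean_le (R : realFieldType) (N : nat) (x : 'I_N -> R) :
  (N%:R^-1 * \sum_(i < N) x i) ^+ 2 <= N%:R^-1 * \sum_(i < N) x i ^+ 2.
Proof.
case: N x => [|N] x; first by rewrite !big_ord0 !mulr0 expr0n.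
set c := _ * \sum_(i < _) x i.
have N0 : (N.+1%:R : R) != 0 by rewrite pnatr_eq0.
have sx : \sum_(i < N.+1) x i = N.+1%:R * c by rewrite mulrA divff// mul1r.
have /(mulr_ge0 (_ : 0 <= N.+1%:R^-1 :> R)) :
    0 <= \sum_(i < N.+1) (x i - c) ^+ 2.
  by apply: sumr_ge0 => i _; exact: sqr_ge0.
have -> : \sum_(i < N.+1) (x i - c) ^+ 2 =
    \sum_(i < N.+1) x i ^+ 2 - N.+1%:R * c ^+ 2.
  under eq_bigr do rewrite sqrrB.
  rewrite big_split sumrB /= sumr_const card_ord sumrMnl -mulr_suml sx.
  by rewrite -mulr_natl; ring.
rewrite mulrBr mulKf// subr_ge0; apply.
by rewrite invr_ge0.
Qed.

Local Open Scope ereal_scope.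

Lemma norm_pi_sqr (R : realType) (m : nat) (pi : probability 'rV[R]_m R)
    (g : 'rV[R]_m -> 'rV[R]_m) :
  norm_pi pi g ^+ 2 = \int[pi]_x (\sum_(k < m) g x 0%R k ^+ 2)%:E.
Proof.
rewrite /norm_pi sqr_sqrte; last first.
  by apply: integral_ge0 => x _; rewrite lee_fin sqr_ge0.
by apply: eq_integral => x _; rewrite enorm_sqr.
Qed.

(** A real value [r] of the integral already forces integrability under [D], because the integral of
    a measurable function is finite exactly when that of its absolute value is. Both facts pass to
    [X] through the pushforward measure. *)
Lemma same_law_integral (R : realType) (dO dZ : measure_display)
    (Omega : measurableType dO) (Z : measurableType dZ)
    (P : probability Omega R) (D : probability Z R) (X : {RV P >-> Z})
    (f : Z -> R) (r : R) :
  (forall A, measurable A -> distribution P X A = D A) ->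
  measurable_fun setT f -> \int[D]_z (f z)%:E = r%:E ->
  P.-integrable setT (fun w => (f (X w))%:E) /\
  \int[P]_w (f (X w))%:E = r%:E.
Proof.
move=> XD mf fr.
have mX : measurable_fun setT X by [].
have mE : measurable_fun setT (EFin \o f) by exact/measurable_EFinP.
have intf : P.-integrable setT (fun w => (f (X w))%:E).
  apply/integrableP; split; first exact: (measurableT_comp mE).
  have <- : \int[pushforward P X]_z `|(f z)%:E| = \int[P]_w `|(f (X w))%:E|.
    by apply: (ge0_integral_pushforward mX) => //; exact: measurableT_comp.
  rewrite (eq_measure_integral D) => [|A mA _]; last exact: XD.
  by rewrite integral_fin_num_abs// fr.
split=> //; rewrite -fr.
rewrite -(_ : \int[pushforward P X]_z (f z)%:E = \int[P]_w (f (X w))%:E).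
  by apply: eq_measure_integral => A mA _; exact: XD.
exact: (integral_pushforward mX mE).
Qed.

(** * Bias-variance identity on a product of probability spaces *)

Section bias_variance.
Variables (R : realType) (d1 d2 : measure_display).
Variables (T1 : measurableType d1) (T2 : measurableType d2).
Variables (P : probability T1 R) (Q : probability T2 R) (m : nat).
(** In the application [a] holds the coordinates of the sampling error, centred in the sample for
    each parameter, and [b] those of the source-target gap, which does not depend on the sample. *)
Variables (a : 'I_m -> T1 * T2 -> R) (b : 'I_m -> T2 -> R).
Hypothesis ma : forall k, measurable_fun setT (a k).
Hypothesis mb : forall k, measurable_fun setT (b k).
Hypothesis ia : forall k y, P.-integrable setT (fun x => (a k (x, y))%:E).
Hypothesis a0 : forall k y, \int[P]_x (a k (x, y))%:E = 0.
Hypothesis a2 : \int[P \x Q]_p (\sum_(k < m) a k p ^+ 2)%:E < +oo.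
Hypothesis b2 : \int[Q]_y (\sum_(k < m) b k y ^+ 2)%:E < +oo.

Let A p := (\sum_(k < m) a k p ^+ 2)%R.
Let B (p : T1 * T2) := (\sum_(k < m) b k p.2 ^+ 2)%R.
Let C (p : T1 * T2) := (\sum_(k < m) a k p * b k p.2)%R.

Let mb2 k : measurable_fun setT (fun p : T1 * T2 => b k p.2).
Proof. exact: measurableT_comp measurable_snd. Qed.

Let mA : measurable_fun setT A.
Proof. by apply: measurable_sum => k; exact: measurable_funX. Qed.

Let mB : measurable_fun setT B.
Proof. by apply: measurable_sum => k; exact: measurable_funX. Qed.

Let mC : measurable_fun setT C.
Proof. by apply: measurable_sum => k; exact: measurable_funM. Qed.

Let A_ge0 p : (0 <= A p)%R.
Proof. by apply: sumr_ge0 => k _; exact: sqr_ge0. Qed.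

Let B_ge0 p : (0 <= B p)%R.
Proof. by apply: sumr_ge0 => k _; exact: sqr_ge0. Qed.

Let intB : \int[P \x Q]_p (B p)%:E = \int[Q]_y (\sum_(k < m) b k y ^+ 2)%:E.
Proof.
rewrite (@fubini_tonelli1 _ _ _ _ _ P Q (EFin \o B)).
(* The inner integral is the same for every sample, so it is taken at the arbitrary [point]; [P] has
   mass 1. *)
- rewrite (_ : fubini_F Q (EFin \o B) = cst (\int[Q]_y (B (point, y))%:E))//.
  rewrite integral_cst// [X in _ * X](_ : _ = 1) ?mule1//.
  exact: probability_setT.
- exact/measurable_EFinP.
- by move=> p; rewrite lee_fin.
Qed.

Let iA : (P \x Q).-integrable setT (EFin \o A).
Proof.
apply/integrableP; split; first exact/measurable_EFinP.
by under eq_integral do rewrite /= ger0_norm//.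
Qed.

Let iB : (P \x Q).-integrable setT (EFin \o B).
Proof.
apply/integrableP; split; first exact/measurable_EFinP.
under eq_integral do rewrite /= ger0_norm//.
by rewrite intB.
Qed.

Let iC : (P \x Q).-integrable setT (EFin \o C).
Proof.
apply: (@le_integrable _ _ _ _ _ _ _ ((EFin \o A) \+ (EFin \o B))) => //.
- exact/measurable_EFinP.
- move=> p _ /=; rewrite lee_fin [leRHS]ger0_norm ?addr_ge0//.
  rewrite /A /B /C -big_split /=; apply: le_trans (ler_norm_sum _ _ _) _.
  apply: ler_sum => k _; rewrite normrM.
  rewrite -(real_normK (num_real (a k p))) -(real_normK (num_real (b k p.2))).
  have := sqr_ge0 (`|a k p| - `|b k p.2|).
  have := sqr_ge0 (`|a k p| + `|b k p.2|); lra.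
- exact: integrableD.
Qed.

Let intC : \int[P \x Q]_p (C p)%:E = 0.
Proof.
(* This order puts [P] inside: at fixed y each [b k y] is a scalar, and [a0] kills every summand. *)
rewrite -(integral21_prod_meas1 iC) /fubini_G integral0_eq// => y _.
under eq_integral do rewrite /= /C /= -sumEFin.
rewrite integral_sum//=.
  rewrite big1// => k _.
  under eq_integral do rewrite EFinM.
  by rewrite integralZr// a0 mul0e.
move=> k; under eq_fun do rewrite EFinM.
exact: integrableZr.
Qed.

Lemma bias_variance (s t : R) :
  \int[P \x Q]_p (\sum_(k < m) (s * a k p + t * b k p.2) ^+ 2)%:E =
  (s ^+ 2)%:E * \int[P \x Q]_p (\sum_(k < m) a k p ^+ 2)%:E +
  (t ^+ 2)%:E * \int[Q]_y (\sum_(k < m) b k y ^+ 2)%:E.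
Proof.
rewrite -intB.
transitivity (\int[P \x Q]_p ((s ^+ 2)%:E * (A p)%:E + (t ^+ 2)%:E * (B p)%:E +
    (2 * s * t)%:E * (C p)%:E)).
  apply: eq_integral => p _; rewrite -!EFinM -!EFinD; congr EFin.
  rewrite /A /B /C !mulr_sumr -!big_split /=; apply: eq_bigr => k _; ring.
have iZ (r : R) (f : T1 * T2 -> R) : (P \x Q).-integrable setT (EFin \o f) ->
    (P \x Q).-integrable setT (fun p => r%:E * (f p)%:E).
  exact: integrableZl.
rewrite integralD//; [|by apply: integrableD => //; exact: iZ|exact: iZ].
rewrite integralD//; [|exact: iZ..].
by rewrite !integralZl// intC mule0 adde0.
Qed.

End bias_variance.

(** * Expected squared norms as product integrals, and bounds in L^pi *)

Lemma int_norm_pi_sqr (R : realType) (m : nat) (pi : probability 'rV[R]_m R)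
    (d : measure_display) (T : measurableType d) (P : probability T R)
    (g : T -> 'rV[R]_m -> 'rV[R]_m) :
  (forall k, measurable_fun setT (fun p : T * 'rV[R]_m => g p.1 p.2 0%R k)) ->
  \int[P]_w norm_pi pi (g w) ^+ 2 =
  \int[P \x pi]_p (\sum_(k < m) g p.1 p.2 0%R k ^+ 2)%:E.
Proof.
move=> mg.
rewrite fubini_tonelli1.
- by apply: eq_integral => w _; rewrite norm_pi_sqr.
- apply/measurable_EFinP; apply: measurable_sum => k.
  exact: measurable_funX (mg k).
- by move=> p; rewrite lee_fin sumr_ge0// => k _; exact: sqr_ge0.
Qed.

Lemma in_Lpi_coord (R : realType) (m : nat) (pi : probability 'rV[R]_m R)
    (g : 'rV[R]_m -> 'rV[R]_m) :
  in_Lpi pi g -> forall k, measurable_fun setT (fun x => g x 0%R k).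
Proof.
by move=> [mg _] k; exact: measurableT_comp (measurable_coord _ _ _ _ _) mg.
Qed.

Lemma in_Lpi_integral (R : realType) (m : nat) (pi : probability 'rV[R]_m R)
    (g : 'rV[R]_m -> 'rV[R]_m) :
  in_Lpi pi g ->
  pi.-integrable setT (fun x => (\sum_(k < m) g x 0%R k ^+ 2)%:E).
Proof.
move=> gL; have mg := in_Lpi_coord _ _ _ _ gL.
apply/integrableP; split.
  by apply/measurable_EFinP; apply: measurable_sum => k; exact: measurable_funX.
under eq_integral => x _.
  rewrite gee0_abs; last by rewrite lee_fin sumr_ge0// => k _; exact: sqr_ge0.
  over.
rewrite -norm_pi_sqr; case: gL => _.
have : 0 <= norm_pi pi g by exact: sqrte_ge0.
by case: (norm_pi pi g) => //= r _ _; rewrite ltry.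
Qed.

(** Coordinatewise (u - v)^2 <= 2 u^2 + 2 v^2, which is a rearrangement of (u + v)^2 >= 0. *)
Lemma norm_piB_lty (R : realType) (m : nat) (pi : probability 'rV[R]_m R)
    (g h : 'rV[R]_m -> 'rV[R]_m) : in_Lpi pi g -> in_Lpi pi h ->
  \int[pi]_x (\sum_(k < m) (g \- h)%R x 0%R k ^+ 2)%:E < +oo.
Proof.
move=> gL hL.
have mg := in_Lpi_coord _ _ _ _ gL; have mh := in_Lpi_coord _ _ _ _ hL.
have iS (f : 'rV[R]_m -> 'rV[R]_m) : in_Lpi pi f ->
    pi.-integrable setT (fun x => 2%:E * (\sum_(k < m) f x 0%R k ^+ 2)%:E).
  by move=> fL; apply: integrableZl => //; exact: in_Lpi_integral.
apply: integrable_lty => //.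
apply: le_integrable (integrableD measurableT (iS g gL) (iS h hL)) => //.
  apply/measurable_EFinP; apply: measurable_sum => k; apply: measurable_funX.
  under eq_fun do rewrite /= mxBE.
  exact: measurable_funB.
move=> x _ /=; rewrite lee_fin.
rewrite !mulr_sumr -big_split /= !ger0_norm; last 2 first.
- by apply: sumr_ge0 => k _; rewrite addr_ge0// mulr_ge0// sqr_ge0.
- by apply: sumr_ge0 => k _; exact: sqr_ge0.
apply: ler_sum => k _; rewrite mxBE.
by have := sqr_ge0 (g x 0 k + h x 0 k)%R; lra.
Qed.

(** * Unbiasedness of the empirical gradient and the FedDA bound *)

(** Each sample has law [DT], so the interchange of gradient and expectation gives its partial
    derivative the mean [grad_risk loss DT]; averaging n > 0 of them preserves this mean. *)
Lemma emp_grad_unbiased (R : realType) (m : nat) (dZ : measure_display)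
    (Z : measurableType dZ) (loss : 'rV[R]_m -> Z -> R) (DT : probability Z R)
    (dO : measure_display) (Omega : measurableType dO)
    (P : probability Omega R) (n : nat) (X : 'I_n -> {RV P >-> Z}) :
  (0 < n)%N ->
  measurable_fun setT (fun p : 'rV[R]_m * Z => loss p.1 p.2) ->
  (forall z t, differentiable (loss ^~ z) t) ->
  (forall x k, 'E_DT[fun z => gradient (loss ^~ z) x 0%R k] =
     (grad_risk loss DT x 0%R k)%:E) ->
  (forall j A, measurable A -> distribution P (X j) A = DT A) ->
  forall x k,
    let err w :=
      (grad_risk loss DT \- grad_emp_risk loss (fun j => X j w))%R x 0%R k in
    P.-integrable setT (fun w => (err w)%:E) /\ \int[P]_w (err w)%:E = 0.
Proof.
move=> n0 mloss dloss DTg XD x k err.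
pose g z := gradient (loss ^~ z) x 0%R k.
have mg : measurable_fun setT g.
  rewrite /g; under eq_fun do rewrite mxE.
  have mD : measurable_fun setT
      (fun p : 'rV[R]_m * Z => 'D_(delta_mx 0%R k) (loss ^~ p.2) p.1).
    by apply: measurable_derive_param => // t z; exact: diff_derivable.
  exact: (measurableT_comp mD (pair1_measurable x)).
have Eg : \int[DT]_z (g z)%:E = (grad_risk loss DT x 0%R k)%:E.
  by rewrite -DTg unlock.
have /all_and2[iX EX] j :=
  same_law_integral _ _ _ _ _ _ _ (X j) g _ (XD j) mg Eg.
have errE w : (err w)%:E = (grad_risk loss DT x 0%R k)%:E -
    (n%:R^-1)%:E * \sum_(j < n) (g (X j w))%:E.
  rewrite sumEFin -EFinM -EFinB; congr EFin.
  by rewrite /err /= mxBE grad_emp_riskE.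
have iS : P.-integrable setT (fun w => \sum_(j < n) (g (X j w))%:E).
  exact: integrable_sum.
have iM : P.-integrable setT
    (fun w => (n%:R^-1)%:E * \sum_(j < n) (g (X j w))%:E).
  exact: integrableZl.
have ic : P.-integrable setT (cst (grad_risk loss DT x 0%R k)%:E).
  exact: finite_measure_integrable_cst.
split; first by under eq_fun do rewrite errE; exact: integrableB.
under eq_integral do rewrite errE.
rewrite integralB// integral_cst// [X in _ * X](_ : _ = 1) ?mule1; last first.
  exact: probability_setT.
rewrite integralZl// integral_sum//.
under eq_bigr do rewrite EX.
rewrite sumEFin sumr_const card_ord -EFinM -[X in (_ * X)%R]mulr_natl mulKf.
  by rewrite -EFinB subrr.
by rewrite pnatr_eq0 -lt0n.
Qed.
Theorem theorem4p2 (R : realType) (m : nat)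
    (pi : probability 'rV[R]_m R)
    (dZ : measure_display) (Z : measurableType dZ)
    (loss : 'rV[R]_m -> Z -> R)
    (loss_ge0 : forall theta z, (0 <= loss theta z)%R)
    (loss_meas : measurable_fun setT (fun p : 'rV[R]_m * Z => loss p.1 p.2))
    (loss_diff : forall z theta, differentiable (fun t => loss t z) theta)
    (N : nat) (N_gt0 : (1 <= N)%N)
    (DS : 'I_N -> probability Z R) (DT : probability Z R)
    (DS_reg : forall i, regular_domain loss (DS i))
    (DT_reg : regular_domain loss DT)
    (DT_grad : forall theta k,
       'E_DT[fun z => gradient (fun t => loss t z) theta 0%R k] =
       (grad_risk loss DT theta 0%R k)%:E)
    (dO : measure_display) (Omega : measurableType dO)
    (P : probability Omega R)
    (n : nat) (n_gt0 : (1 <= n)%N)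
    (X : 'I_n -> {RV P >-> Z}) (X_iid : iid_samples DT X)
    (DS_Lpi : forall i, in_Lpi pi (grad_risk loss (DS i)))
    (DT_Lpi : in_Lpi pi (grad_risk loss DT))
    (emp_Lpi : {ae P, forall w,
       in_Lpi pi (grad_emp_risk loss (fun j => X j w))})
    (var_fin : target_variance pi loss DT X < +oo)
    (beta : 'I_N -> R) (beta01 : forall i, (0 <= beta i <= 1)%R) :
  delta_error2 pi P loss DT (fun w => fedda loss beta DS (fun j => X j w))
    <= (N%:R^-1)%:E *
       \sum_(i < N) delta_error2_source pi loss DT X (beta i) (DS i).
Proof.
move=> {loss_ge0 DS_reg DT_reg emp_Lpi}.
pose a k (p : Omega * 'rV[R]_m) := (grad_risk loss DT \-
  grad_emp_risk loss (fun j => X j p.1))%R p.2 0%R k.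
pose b i k x := (grad_risk loss DT \- grad_risk loss (DS i))%R x 0%R k.
have mDT := in_Lpi_coord _ _ _ _ DT_Lpi.
have mDS i := in_Lpi_coord _ _ _ _ (DS_Lpi i).
have mb i k : measurable_fun setT (b i k).
  rewrite /b; under eq_fun do rewrite /= mxBE.
  exact: measurable_funB.
have ma k : measurable_fun setT (a k).
  (* Expanded sample by sample, the error involves only the loss derivative composed with the
     measurable map (w, theta) -> (theta, [X j w]). *)
  have -> : a k = (fun p => grad_risk loss DT p.2 0%R k - n%:R^-1 *
      \sum_(j < n) 'D_(delta_mx 0%R k) (loss ^~ (X j p.1)) p.2)%R.
    apply/funext => p; rewrite /a /= mxBE grad_emp_riskE//.
    by congr (_ - _ * _)%R; apply: eq_bigr => j _; rewrite mxE.
  apply: measurable_funB; first exact: measurableT_comp (mDT k) measurable_snd.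
  apply: measurable_funM => //; apply: measurable_sum => j.
  have mD : measurable_fun setT
      (fun p : 'rV[R]_m * Z => 'D_(delta_mx 0%R k) (loss ^~ p.2) p.1).
    by apply: measurable_derive_param => // t z; exact: diff_derivable.
  have mX : measurable_fun setT (fun p : Omega * 'rV[R]_m => (p.2, X j p.1)).
    by apply: measurable_fun_pair => //; exact: measurableT_comp.
  exact: (measurableT_comp mD mX).
have varE : target_variance pi loss DT X =
    \int[P \x pi]_p (\sum_(k < m) a k p ^+ 2)%:E.
  by rewrite /target_variance int_norm_pi_sqr.
pose c i p := (\sum_(k < m) ((1 - beta i) * a k p + beta i * b i k p.2) ^+ 2)%R.
have mc0 i k :
    measurable_fun setT (fun p => (1 - beta i) * a k p + beta i * b i k p.2)%R.
  apply: measurable_funD; apply: measurable_funM => //.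
  exact: measurableT_comp (mb i k) measurable_snd.
have mc i : measurable_fun setT (EFin \o c i).
  by apply/measurable_EFinP; apply: measurable_sum => k; exact: measurable_funX.
have c0 i p : 0 <= (c i p)%:E.
  by rewrite lee_fin sumr_ge0// => k _; exact: sqr_ge0.
(* Each source error is an exact integral of [c i], so the inequality of the theorem comes only from
   pointwise convexity. *)
have sourceE i : delta_error2_source pi loss DT X (beta i) (DS i) =
    \int[P \x pi]_p (c i p)%:E.
  rewrite bias_variance//.
  - by rewrite /delta_error2_source varE /dist_pi norm_pi_sqr.
  - by move=> k x; have [] := emp_grad_unbiased _ _ _ _ loss DT _ _ P n X
      n_gt0 loss_meas loss_diff DT_grad X_iid.2 x k.
  - by move=> k x; have [] := emp_grad_unbiased _ _ _ _ loss DT _ _ P n X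
      n_gt0 loss_meas loss_diff DT_grad X_iid.2 x k.
  (* Finite target variance is square integrability of the sampling error on the product space. *)
  - by rewrite -varE.
  - exact: (norm_piB_lty _ _ _ _ _ DT_Lpi (DS_Lpi i)).
pose e w := (grad_risk loss DT \- fedda loss beta DS (fun j => X j w))%R.
have eE p k : e p.1 p.2 0%R k = (N%:R^-1 *
    \sum_(i < N) ((1 - beta i) * a k p + beta i * b i k p.2))%R.
  rewrite /e /a /b /= mxBE fedda_coord.
  have N0 : (N%:R : R) != 0%R by rewrite pnatr_eq0 -lt0n.
  set G := grad_risk loss DT p.2 0%R k.
  (* The target gradient is written as the average of N copies of itself, valid as N > 0; in each
     copy the weights [1 - beta i] and [beta i] sum to 1, so the error becomes an average of mixed
     errors. *)
  have GE : G = (N%:R^-1 * \sum_(i < N) G)%R.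
    by rewrite sumr_const card_ord -[X in (_ * X)%R]mulr_natl mulKf.
  rewrite {1}GE -mulrBr -sumrB; congr (_ * _)%R; apply: eq_bigr => i _.
  by rewrite !mxBE -/G; ring.
have me k : measurable_fun setT (fun p => e p.1 p.2 0%R k).
  under eq_fun do rewrite eE.
  by apply: measurable_funM => //; apply: measurable_sum => i.
under eq_bigr do rewrite sourceE.
have msum : measurable_fun setT (fun p => \sum_(i < N) (c i p)%:E).
  by apply: emeasurable_sum => i; exact: mc.
(* Both sides become integrals of nonnegative functions over the same product space, leaving a
   pointwise comparison. *)
rewrite -ge0_integral_sum// -ge0_integralZl//; last first.
  by move=> p _; exact: sume_ge0.
rewrite /delta_error2 -/e int_norm_pi_sqr//.
apply: ge0_le_integral => //.
- by move=> p _; rewrite lee_fin sumr_ge0// => k _; exact: sqr_ge0.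
- by apply/measurable_EFinP; apply: measurable_sum => k; exact: measurable_funX.
- exact: emeasurable_funM.
(* Exchanging the sums over sources and coordinates lets [sqr_mean_le] act on one coordinate at a
   time. *)
move=> p _; rewrite sumEFin -EFinM lee_fin exchange_big mulr_sumr /=.
by apply: ler_sum => k _; rewrite eE; exact: sqr_mean_le.
Qed.
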